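(* Let $\Delta$ be a simplicial complex on $[d]=\{1,\ldots,d\}$, let $A_\Delta$ be its incidence matrix, and let $I_{A_\Delta}$ be the toric ideal of $A_\Delta$ over a field $K$. Then the following conditions are equivalent: (i) there exists a perfect graph $G$ on $[d]$ with $\Delta = S(G)$, where $S(G)$ is the set of stable sets of $G$; (ii) $A_\Delta$ is compressed; (iii) $I_{A_\Delta}$ possesses a squarefree initial ideal with respect to a reverse lexicographic order whose smallest variable corresponds to the column $\mathbf{0}\in\mathbb{Z}^d$ of $A_\Delta$.
   Context: A simplicial complex $\Delta$ on $[d]$ is a collection of subsets of $[d]$ with $\{i\}\in\Delta$ for every $i\in[d]$, such that $F\in\Delta$ and $F'\subset F$ imply $F'\in\Delta$ (so $\emptyset\in\Delta$). For $W\subset[d]$ put $\rho(W)=\sum_{j\in W}\mathbf{e}_j\in\mathbb{R}^d$, where $\mathbf{e}_j$ are the standard unit vectors. The incidence matrix $A_\Delta$ is the matrix whose columns are the vectors $\rho(F)$, $F\in\Delta$; it includes the column $\rho(\emptyset)=\mathbf{0}$. For an integer $d\times n$ matrix $M=[\mathbf{c}_1,\ldots,\mathbf{c}_n]$ and a field $K$, the toric ideal $I_M$ is the kernel of the ring homomorphism $K[x_1,\ldots,x_n]\to K[t_1^{\pm1},\ldots,t_d^{\pm1},s]$, $x_j\mapsto\mathbf{t}^{\mathbf{c}_j}s = t_1^{c_{1j}}\cdots t_d^{c_{dj}}s$; the variable $x_j$ corresponds to the column $\mathbf{c}_j$. A reverse lexicographic order is the graded reverse lexicographic monomial order induced by some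 total ordering of the variables: $u<v$ iff $\deg u<\deg v$, or $\deg u=\deg v$ and the smallest variable whose exponents in $u$ and $v$ differ has larger exponent in $u$. An initial ideal is squarefree if it is generated by squarefree monomials. An integer matrix $M$ is compressed if the initial ideal of $I_M$ is squarefree with respect to every reverse lexicographic order. Graphs are finite and simple. A subset $W\subset[d]$ is stable in $G$ if no two distinct elements of $W$ form an edge of $G$; $S(G)$ denotes the set of all stable sets of $G$ (a simplicial complex on $[d]$). A graph $G$ is perfect if for every induced subgraph $H$ of $G$ (including $G$) the chromatic number of $H$ equals the maximal cardinality of cliques of $H$. *)

(* Defs.v *)
From HB Require Import structures.
From mathcomp Require Import all_boot all_order all_algebra.
From mathcomp Require Import fraction.
From mathcomp Require Import mpoly.

Set Implicit Arguments.
Unset Strict Implicit.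
Unset Printing Implicit Defensive.

Import GRing.Theory.

Local Open Scope ring_scope.

Record sgraph (T : finType) := SGraph {
  edge : rel T;
  edge_sym : ssrbool.symmetric edge;
  edge_irrefl : irreflexive edge
}.

Section Graphs.
Variables (T : finType) (G : sgraph T).

Definition stable (W : {set T}) : bool :=
  [forall x in W, forall y in W, (x != y) ==> ~~ edge G x y].

Definition stable_sets : {set {set T}} := [set W | stable W].

Definition clique (W : {set T}) : bool :=
  [forall x in W, forall y in W, (x != y) ==> edge G x y].

Definition clique_number : nat := (\max_(W : {set T} | clique W) #|W|)%N.

Definition colorable (k : nat) : bool :=
  [exists f : {ffun T -> 'I_k}, forall x, forall y, edge G x y ==> (f x != f y)].

Lemma colorable_ex : exists k, colorable k.
Proof.
exists #|T|; apply/existsP; exists [ffun x => enum_rank x].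
apply/forallP => x; apply/forallP => y; apply/implyP => exy.
rewrite !ffunE; apply: contraTneq exy => /enum_rank_inj ->.
by rewrite edge_irrefl.
Qed.

Definition chromatic_number : nat := ex_minn colorable_ex.

Variable W : {set T}.

Lemma induced_sym : ssrbool.symmetric (relpre (val : {x | x \in W} -> T) (edge G)).
Proof. by move=> x y; apply: edge_sym. Qed.

Lemma induced_irrefl : irreflexive (relpre (val : {x | x \in W} -> T) (edge G)).
Proof. by move=> x; apply: edge_irrefl. Qed.

Definition induced : sgraph {x | x \in W} := SGraph induced_sym induced_irrefl.

End Graphs.

Definition perfect (T : finType) (G : sgraph T) : Prop :=
  forall W : {set T},
    chromatic_number (induced G W) = clique_number (induced G W).

(* The vertex set {1, ..., d} is ['I_d].  Membership of the empty face is required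
   explicitly; it follows from the other two conditions unless [d = 0]. *)
Definition simplicial_complex (d : nat) (Delta : {set {set 'I_d}}) : Prop :=
  [/\ set0 \in Delta,
      forall i : 'I_d, [set i] \in Delta
    & forall F F' : {set 'I_d}, F \in Delta -> F' \subset F -> F' \in Delta].

Definition rho (d : nat) (W : {set 'I_d}) : 'cV[int]_d :=
  \sum_(j in W) delta_mx j 0.

Definition incidence_matrix (d : nat) (Delta : {set {set 'I_d}}) :
    'M[int]_(d, #|Delta|) :=
  \matrix_(i, j) rho (enum_val j) i 0.

Section ToricIdeal.
Variables (K : fieldType) (d n : nat).

(* The Laurent polynomial ring K[t_1^{+-1}, ..., t_d^{+-1}, s] is taken inside
   the fraction field K(t_1, ..., t_d, s); enlarging the codomain of a ring
   homomorphism in this way does not change its kernel. *)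
Definition rat_fun := {fraction {mpoly K[d.+1]}}.

Definition tvar (i : 'I_d) : rat_fun := tofrac 'X_(widen_ord (leqnSn d) i).
Definition svar : rat_fun := tofrac 'X_ord_max.

Definition toric_monomial (c : 'cV[int]_d) : rat_fun :=
  (\prod_(i < d) exprz (tvar i) (c i 0)) * svar.

Definition toric_hom (M : 'M[int]_(d, n)) (p : {mpoly K[n]}) : rat_fun :=
  mmap (fun a : K => tofrac a%:MP) (fun j => toric_monomial (col j M)) p.

Definition toric_ideal (M : 'M[int]_(d, n)) (p : {mpoly K[n]}) : Prop :=
  toric_hom M p = 0.

End ToricIdeal.

Definition total_ordering (T : Type) (r : rel T) : Prop :=
  [/\ reflexive r, antisymmetric r, transitive r & total r].

(* [r i j] means that the variable 'X_i is at most 'X_j. *)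
Definition revlex_lt (n : nat) (r : rel 'I_n) (u v : 'X_{1..n}) : Prop :=
  (mdeg u < mdeg v)%N \/
  mdeg u = mdeg v /\
  exists2 i : 'I_n, (v i < u i)%N
    & forall j : 'I_n, r j i -> j != i -> u j = v j.

Section InitialIdeal.
Variables (K : fieldType) (n : nat).
Implicit Types (lt : 'X_{1..n} -> 'X_{1..n} -> Prop).
Implicit Types (I : {mpoly K[n]} -> Prop).

Definition ideal_generated_by (S : {mpoly K[n]} -> Prop) (p : {mpoly K[n]}) :
    Prop :=
  exists s : seq ({mpoly K[n]} * {mpoly K[n]}),
    (forall x, x \in s -> S x.2) /\ p = \sum_(x <- s) x.1 * x.2.

Definition initial_monomial lt (p : {mpoly K[n]}) (m : 'X_{1..n}) : Prop :=
  m \in msupp p /\ forall m', m' \in msupp p -> m' != m -> lt m' m.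

Definition initial_ideal lt I : {mpoly K[n]} -> Prop :=
  ideal_generated_by
    (fun q => exists p m, [/\ I p, initial_monomial lt p m & q = 'X_[m]]).

Definition squarefree_monomial (m : 'X_{1..n}) : Prop :=
  forall i, (m i <= 1)%N.

Definition squarefree_ideal I : Prop :=
  exists S : 'X_{1..n} -> Prop,
    (forall m, S m -> squarefree_monomial m) /\
    forall p, I p <-> ideal_generated_by (fun q => exists2 m, S m & q = 'X_[m]) p.

End InitialIdeal.

Definition compressed (K : fieldType) (d n : nat) (M : 'M[int]_(d, n)) : Prop :=
  forall r : rel 'I_n, total_ordering r ->
    squarefree_ideal (initial_ideal (revlex_lt r) (@toric_ideal K d n M)).

(* Main.v *)
Require Import Defs.
From mathcomp Require Import all_boot all_order all_algebra.
From mathcomp Require Import mpoly.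
From mathcomp Require Import fraction zify.
From Stdlib Require Import ClassicalEpsilon.

(** The exponents of a monomial in the variables x_F, F in Delta, describe a
    multiset of faces; two monomials of the same degree k lie in the same fiber
    of the toric map when both multisets cover every vertex equally often, that
    is, when they write the same vertex weight w as a sum of k faces.  The toric
    ideal is spanned by differences of two monomials in one fiber, so a monomial
    lies in the initial ideal exactly when it is not the least element of its
    fiber ([initial_toric_ideal]), and the initial ideal is squarefree exactly
    when this property passes from a monomial to its squarefree part.  This
    turns the theorem into a statement about sums of faces.

    Perfect implies compressed.  For a perfect graph, a weight w is a sum of k
    stable sets as soon as no clique has weight above k
    ([perfect_decomposition], a weighted form of the replication lemma).  Let u
    be a monomial with a smaller v in its fiber; cancel the common factor and
    let F be the smallest face on which they differ, which now divides v and not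
    u.  Subtracting F from the sum of the distinct faces of u leaves
    a nonnegative weight, of value at most (number of those faces) - 1 on every
    clique: a clique missing F is missed by some face of u because u and v agree
    on it.  Hence this weight decomposes, and adding F back gives a smaller
    monomial in the fiber of the squarefree part of u
    ([nonstandard_squarefree_part]).

    Compressed gives the third condition by ordering the variables with that of
    the empty face first.

    A squarefree initial ideal with x_0 smallest implies perfect, where x_0 is
    the variable of the empty face.  Let f w be the least number of faces
    covering w.  If u is the least monomial in the fiber of (w, f w), then so is
    every power of u in its own fiber, by squarefreeness; a cover of N w
    by fewer than N (f w) faces, padded with copies of the empty face, would be
    smaller than u ^ N.  Hence f (N w) = N (f w) ([cover_number_scaling]), so f
    is an integer-valued gauge.  Differentiating such a gauge, first in the
    direction w and then along all the unit vectors, yields a linear function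
    below f that agrees with f at w; its coefficients are integers between 0 and
    1, so f w is the weight of some set C, and C never meets a face twice
    ([gauge_set_support]).  Such sets C are the cliques of the graph whose edges
    are the two-element nonfaces.  So f w is the maximal weight of a clique.
    Taking w to be an indicator shows that every stable set is a face and that
    each induced subgraph has equal chromatic and clique numbers
    ([perfect_of_homogeneous_cover]). *)

Set Implicit Arguments.
Unset Strict Implicit.
Unset Printing Implicit Defensive.

Import GRing.Theory.

(** * Multisets of finite sets *)

Definition coverage (T : finType) (s : seq {set T}) (i : T) : nat :=
  \sum_(F <- s) (i \in F).

Section Multiplicities.
Variable T : finType.
Implicit Types (s : seq {set T}) (C F : {set T}) (w : T -> nat).

Lemma coverage_nil i : coverage (Nil {set T}) i = 0.
Proof. exact: big_nil. Qed.

Lemma coverage_cons F s i : coverage (F :: s) i = (i \in F) + coverage s i.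
Proof. exact: big_cons. Qed.

Lemma coverage_cat s1 s2 i :
  coverage (s1 ++ s2) i = coverage s1 i + coverage s2 i.
Proof. exact: big_cat. Qed.

Lemma perm_coverage s1 s2 i : perm_eq s1 s2 -> coverage s1 i = coverage s2 i.
Proof. by move=> e; apply: perm_big. Qed.

Lemma coverage_gt0P s i :
  reflect (exists2 F, F \in s & i \in F) (0 < coverage s i).
Proof.
rewrite lt0n /coverage sum_nat_seq_neq0.
by apply: (iffP hasP) => -[F Fs] /=; rewrite ?eqb0 ?negbK => iF; exists F;
  rewrite ?eqb0 ?negbK.
Qed.

Lemma sum_mem C F : \sum_(i in C) (i \in F) = #|C :&: F|.
Proof.
rewrite -sum1_card (big_setID F) /= addnC.
rewrite big1 ?add0n => [|i /setDP[_ /negPf->] //].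
by apply: eq_bigr => i /setIP[_ ->].
Qed.

Lemma sum_coverage s C : \sum_(i in C) coverage s i = \sum_(F <- s) #|C :&: F|.
Proof. by rewrite exchange_big; apply: eq_bigr => F _; apply: sum_mem. Qed.

Lemma leq_sum_coverage s C :
    (forall F, F \in s -> #|C :&: F| <= 1) ->
  \sum_(i in C) coverage s i <= size s.
Proof.
move=> hs; rewrite sum_coverage -sum1_size big_seq [leqRHS]big_seq.
exact: leq_sum.
Qed.

End Multiplicities.

(** * Cliques, stable sets and colourings *)

Section Graphs.
Variables (T : finType) (G : sgraph T).
Implicit Types (W C A : {set T}).

Lemma stableP W :
  reflect {in W &, forall x y, ~~ edge G x y} (stable G W).
Proof.
apply: (iffP idP) => [/forall_inP st x y xW yW | st].
  have [->|nxy] := eqVneq x y; first by rewrite edge_irrefl.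
  by move: (st x xW) => /forall_inP /(_ y yW); rewrite nxy.
by apply/forall_inP => x xW; apply/forall_inP => y yW; rewrite st ?implybT.
Qed.

Lemma cliqueP W :
  reflect {in W &, forall x y, x != y -> edge G x y} (clique G W).
Proof.
apply: (iffP idP) => [/forall_inP cl x y xW yW nxy | cl].
  by move: (cl x xW) => /forall_inP /(_ y yW); rewrite nxy.
apply/forall_inP => x xW; apply/forall_inP => y yW.
by apply/implyP; apply: cl.
Qed.

Lemma stable0 : stable G set0.
Proof. by apply/stableP => x y; rewrite inE. Qed.

Lemma card_clique_stable C A : clique G C -> stable G A -> #|C :&: A| <= 1.
Proof.
move=> /cliqueP cl /stableP st.
apply/card_le1_eqP => x y /setIP[xC xA] /setIP[yC yA].
by apply: contraTeq (st _ _ xA yA) => nxy; rewrite negbK cl // eq_sym.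
Qed.

Lemma leq_clique_number C : clique G C -> #|C| <= clique_number G.
Proof. by move=> cl; apply: (bigmax_sup C). Qed.

Lemma clique_number_chromatic : clique_number G <= chromatic_number G.
Proof.
rewrite /chromatic_number; case: ex_minnP => k /existsP[f /forallP colf] _.
apply/bigmax_leqP => C /cliqueP cl.
have inj : {in C &, injective f}.
  move=> x y xC yC fxy; apply: contraTeq isT => nxy.
  by have /forallP/(_ y) := colf x; rewrite cl // fxy eqxx.
by rewrite -(card_in_imset inj) (leq_trans (max_card _)) ?card_ord.
Qed.

End Graphs.

Section InducedSubgraphs.
Variables (T : finType) (G : sgraph T).
Implicit Types (W C : {set T}) (s : seq {set T}).

Lemma clique_induced W (C : {set {x | x \in W}}) :
  clique (induced G W) C -> clique G (val @: C).
Proof.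
move=> /cliqueP cl.
by apply/cliqueP => _ _ /imsetP[x xC ->] /imsetP[y yC ->]; apply: cl.
Qed.

Lemma clique_number_induced_le W k :
    (forall C, clique G C -> C \subset W -> #|C| <= k) ->
  clique_number (induced G W) <= k.
Proof.
move=> hk; apply/bigmax_leqP => C cl.
rewrite -(card_imset _ val_inj); apply: hk; first exact: clique_induced.
by apply/subsetP => _ /imsetP[x _ ->]; apply: valP.
Qed.

Lemma clique_number_induced_ge W C :
  clique G C -> C \subset W -> #|C| <= clique_number (induced G W).
Proof.
move=> /cliqueP cl /subsetP CW; pose C' := val @^-1: C : {set {x | x \in W}}.
have -> : #|C| = #|C'|.
  rewrite -(card_imset _ val_inj); apply: eq_card => x.
  apply/idP/imsetP => [xC|[y + ->]]; last by rewrite inE.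
  by exists (Sub x (CW x xC)); rewrite ?inE SubK.
apply: leq_clique_number; apply/cliqueP => x y; rewrite !inE => xC yC nxy.
by apply: (cl _ _ xC yC); rewrite val_eqE.
Qed.

Lemma perfect_partition W : perfect G ->
  exists s, [/\ size s = clique_number (induced G W), all (stable G) s
             & forall i, coverage s i = (i \in W)].
Proof.
move=> /(_ W) <-; rewrite /chromatic_number.
case: ex_minnP => k /existsP[f /forallP colf] _.
pose F c := [set val x | x : {x | x \in W} & f x == c].
exists [seq F c | c <- enum 'I_k]; split.
- by rewrite size_map size_enum_ord.
- apply/allP => _ /mapP[c _ ->]; apply/stableP.
  move=> _ _ /imsetP[x + ->] /imsetP[y + ->]; rewrite !inE => /eqP fx /eqP fy.
  apply/negP => exy; have /forallP/(_ y)/implyP/(_ exy) := colf x.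
  by rewrite fx fy eqxx.
- move=> i; rewrite /coverage big_map big_enum /=.
  have [iW|niW] := boolP (i \in W); last first.
    rewrite big1 // => c _; case: imsetP => // -[x _ ix].
    by case/negP: niW; rewrite ix; apply: valP.
  have FE c : (i \in F c) = (c == f (Sub i iW)).
    apply/imsetP/eqP => [[x + ix]|->]; last by exists (Sub i iW); rewrite ?inE.
    by rewrite inE => /eqP <-; congr (f _); apply: val_inj; rewrite SubK.
  rewrite (bigD1 (f (Sub i iW))) //= FE eqxx big1 // => c /negPf.
  by rewrite FE => ->.
Qed.

Lemma chromatic_number_induced_le W s :
    all (stable G) s -> {in W, forall i, 0 < coverage s i} ->
  chromatic_number (induced G W) <= size s.
Proof.
move=> /allP st cov; rewrite /chromatic_number; case: ex_minnP => k _; apply.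
have hi (x : {x | x \in W}) : has (fun F : {set T} => val x \in F) s.
  by apply/hasP/coverage_gt0P/cov/valP.
have hf (x : {x | x \in W}) : find (fun F : {set T} => val x \in F) s < size s.
  by rewrite -has_find; apply: hi.
apply/existsP; exists [ffun x => Ordinal (hf x)].
apply/forallP => x; apply/forallP => y; apply/implyP => exy; rewrite !ffunE.
apply/negP => /eqP/(congr1 val) /= fxy.
have := nth_find set0 (hi x); have := nth_find set0 (hi y); rewrite -fxy.
set F := nth _ _ _ => yF xF; have /stableP sF := st F (mem_nth set0 (hf x)).
by have /negP := sF _ _ xF yF; apply.
Qed.

(** The induction removes one unit of weight at a vertex [v] of weight at least
    2, decomposes the rest into [k] stable sets, and keeps only a set [A] of that
    decomposition which contains [v].  The weight [w - A] has at most [k.-1] on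
    every clique [C]: if [v] lies in [C] then so does a point of [A], and if not
    then the [k - 1] other sets already carry all of [w - A] on [C].  So the
    induction hypothesis applies again, now with [k.-1].  For weights at most 1 a
    decomposition is a colouring of the subgraph induced on the support. *)
Lemma perfect_decomposition (w : T -> nat) k :
    perfect G -> (forall C, clique G C -> \sum_(i in C) w i <= k) ->
  exists s, [/\ size s = k, all (stable G) s & coverage s =1 w].
Proof.
move=> perfG; have [n] := ubnP (\sum_i w i).
elim: n w k => // n IHn w k; rewrite ltnS => sum_w wk.
have [/existsP[v wv]|/existsPn w1] := boolP [exists v, 1 < w v]; last first.
  pose W := [set i | 0 < w i].
  have wW i : (i \in W : nat) = w i.
    by rewrite inE; have := w1 i; case: (w i) => [|[]].
  have [s [size_s st sW]] := perfect_partition W perfG.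
  have hs : size s <= k.
    rewrite size_s; apply: clique_number_induced_le => C cl /subsetP sCW.
    rewrite -sum1_card (leq_trans _ (wk C cl)) //; apply: leq_sum => i /sCW.
    by rewrite inE.
  (* Empty sets bring the number of stable sets up to exactly [k]. *)
  exists (nseq (k - size s) set0 ++ s); split.
  - by rewrite size_cat size_nseq subnK.
  - by rewrite all_cat st all_nseq stable0 orbT.
  - move=> i; rewrite coverage_cat sW wW /coverage big1_seq // => F /andP[_].
    by move=> /nseqP[-> _]; rewrite inE.
pose w' i := w i - (i == v).
have w'E i : w i = w' i + (i == v).
  rewrite /w'; case: eqP => [->|_]; last by rewrite subn0 addn0.
  by rewrite subnK // ltnW.
have sum_v : \sum_i (i == v) = 1.
  by rewrite (bigD1 v) //= eqxx big1 // => i /negPf ->.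
have [|C cl|s [size_s st sw]] := IHn w' k.
- rewrite (leq_trans _ sum_w) // (eq_bigr _ (fun i _ => w'E i)) big_split /=.
  by rewrite sum_v addn1.
- by rewrite (leq_trans _ (wk C cl)) //; apply: leq_sum => i _; apply: leq_subr.
have /coverage_gt0P[A As vA] : 0 < coverage s v by rewrite sw /w' eqxx subn_gt0.
have Aw i : (i \in A) <= w' i.
  by rewrite -sw /coverage (big_rem A) //= leq_addr.
have stA : stable G A by apply: (allP st).
have k0 : 0 < k by rewrite -size_s; case: (s) As.
pose w'' i := w i - (i \in A).
have w''E i : w i = w'' i + (i \in A).
  by rewrite subnK // (leq_trans (Aw i)) // leq_subr.
have [|C cl|s'' [size_s'' st'' sw'']] := IHn w'' k.-1.
- rewrite (leq_trans _ sum_w) // (eq_bigr _ (fun i _ => w''E i)) big_split /=.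
  by rewrite -[ltnLHS]addn0 ltn_add2l (bigD1 v) //= vA.
- have [vC|vC] := boolP (v \in C).
    have := wk C cl; rewrite (eq_bigr _ (fun i _ => w''E i)) big_split /=.
    by rewrite [X in _ + X](bigD1 v) //= vA; lia.
  have sr i : i \in C -> w'' i = coverage (rem A s) i.
    move=> iC; apply: (@addIn (i \in A)); rewrite -w''E w'E.
    rewrite (negPf (memPn vC i iC)) addn0 -sw.
    by rewrite (perm_coverage i (perm_to_rem As)) coverage_cons addnC.
  rewrite (eq_bigr _ sr) -size_s -(size_rem As).
  apply: leq_sum_coverage => F /mem_rem Fs; apply: (card_clique_stable cl).
  exact: (allP st).
exists (A :: s''); split; rewrite /= ?size_s'' ?prednK ?stA //.
by move=> i; rewrite coverage_cons sw'' w''E addnC.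
Qed.

End InducedSubgraphs.

(** * Integer-valued gauges *)

Section Gauges.
Variable V : nmodType.
Implicit Types (f g : V -> nat) (v w x y : V).

(** Monotonicity refers to the order of the monoid: [x] is below [x + y]. *)
Definition gauge f : Prop :=
  [/\ forall x y, f (x + y)%R <= f x + f y,
      forall x n, f (x *+ n)%R = n * f x
    & forall x y, f x <= f (x + y)%R].

Definition additive_along f v : Prop := forall x, f (v + x)%R = f v + f x.

Lemma nonincreasing_eventually_constant (a : nat -> nat) :
  (forall n, a n.+1 <= a n) -> exists l N, forall M, N <= M -> a M = l.
Proof.
move=> dec; have [n] := ubnP (a 0); elim: n a dec => // n IHn a dec an.
case: (classic (exists N, a N < a 0)) => [[N aN]|cst].
  have [||l [N' h]] := IHn (fun m => a (N + m)).
  - by move=> m; rewrite addnS.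
  - by rewrite addn0; lia.
  exists l, (N + N') => M NM; rewrite -(h (M - N)); last lia.
  by congr a; lia.
exists (a 0), 0 => M _; apply/eqP; rewrite eqn_leq leqNgt; apply/andP; split.
  by rewrite -leqNgt; elim: M => // M; apply: leq_trans.
by rewrite leqNgt; apply/negP => aM; apply: cst; exists M.
Qed.

(** The derivative is [g x = lim_n f (n w + x) - n (f w)]; the sequence decreases
    by subadditivity and is nonnegative by monotonicity, hence is eventually
    constant.  Evaluating far along the sequence transfers the gauge properties
    from [f] to [g], and shifting the index by one shows that [g] is additive
    along [w].  Directions along which [f] is already additive stay so, which
    is what allows differentiation to be iterated. *)
Lemma gauge_derivative f w : gauge f ->
  exists g, [/\ gauge g, forall x, g x <= f x,
    additive_along g w /\ g w = f w
    & forall v, additive_along f v -> additive_along g v /\ g v = f v].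
Proof.
move=> [subf homf monof].
have lim x : exists l N, forall M, N <= M -> f (w *+ M + x)%R = M * f w + l.
  have ge n : n * f w <= f (w *+ n + x)%R by rewrite -homf.
  have [|l [N h]] :=
      @nonincreasing_eventually_constant (fun n => f (w *+ n + x)%R - n * f w).
    move=> n; rewrite mulrSr addrAC mulSn; have := subf (w *+ n + x)%R w.
    by move=> le; rewrite subnDA leq_sub2r // leq_subLR addnC.
  by exists l, N => M /h <-; rewrite subnKC.
pose g x := proj1_sig (constructive_indefinite_description _ (lim x)).
have gP x : exists N, forall M, N <= M -> f (w *+ M + x)%R = M * f w + g x.
  exact: proj2_sig (constructive_indefinite_description _ (lim x)).
have add_g v c x : (forall y, f (v + y)%R = c + f y) -> g (v + x)%R = c + g x.
  have [[N1 h1] [N2 h2]] := (gP x, gP (v + x)%R) => add_f.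
  have := h2 (N1 + N2) (leq_addl _ _).
  by rewrite addrCA add_f h1 ?leq_addr //; lia.
have g0 : g 0%R = 0.
  by have [N /(_ N (leqnn _))] := gP 0%R; rewrite addr0 homf; lia.
have add_gw x : g (w + x)%R = f w + g x.
  have [[N1 h1] [N2 h2]] := (gP x, gP (w + x)%R).
  have := h2 (N1 + N2) (leq_addl _ _).
  by rewrite addrA -mulrSr h1 ?mulSn; lia.
have gw : g w = f w by rewrite -[w]addr0 add_gw g0 addr0 addn0.
exists g; split.
- split=> [x y|x [|n]|x y].
  + have [[[N1 h1] [N2 h2]] [N3 h3]] := (gP x, gP y, gP (x + y)%R).
    pose M := N1 + N2 + N3.
    have := subf (w *+ M + x)%R (w *+ M + y)%R.
    rewrite addrACA -mulrnDr h1 ?h2 ?h3 /M; lia.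
  + by rewrite mulr0n g0.
  + have [[N1 h1] [N2 h2]] := (gP x, gP (x *+ n.+1)%R).
    have := homf (w *+ (N1 + N2) + x)%R n.+1.
    rewrite mulrnDl -mulrnA h1 ?h2; [nia|nia|lia].
  + have [[N1 h1] [N2 h2]] := (gP x, gP (x + y)%R).
    have := monof (w *+ (N1 + N2) + x)%R y.
    by rewrite -addrA h1 ?h2; lia.
- move=> x; have [N h] := gP x.
  by have := subf (w *+ N)%R x; rewrite h // homf; lia.
- by split=> // x; rewrite add_gw gw.
- move=> v add_f; have gv : g v = f v.
    by rewrite -[v]addr0 (add_g v (f v)) // g0 addr0 addn0.
  by split=> // x; rewrite (add_g v (f v)) ?gv.
Qed.

(** A discrete Hahn-Banach theorem. *)
Lemma gauge_support f w (e : seq V) : gauge f ->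
  exists g, [/\ gauge g, forall x, g x <= f x, g w = f w
    & {in e, forall v, additive_along g v}].
Proof.
move=> gauge_f.
suff: exists g, [/\ gauge g, forall x, g x <= f x,
    additive_along g w /\ g w = f w & {in e, forall v, additive_along g v}].
  by move=> [g [? ? [] *]]; exists g.
elim: e => [|v e [g [gauge_g gf [gw gwf] ge]]].
  by have [g [? ? ? _]] := gauge_derivative w gauge_f; exists g; split.
have [h [gauge_h hg [hv _] pres]] := gauge_derivative v gauge_g.
exists h; split=> // [x||u].
- exact: leq_trans (hg x) (gf x).
- by have [? ->] := pres w gw.
- by rewrite inE => /predU1P[->//|/ge/pres[]].
Qed.

End Gauges.

(** A gauge that is additive along every unit vector is linear with natural
    coefficients; the bound by 1 on unit vectors leaves only the coefficients 0
    and 1, so the supporting linear function is the weight of a set. *)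
Lemma gauge_set_support (T : finType) (f : {ffun T -> nat} -> nat) w :
    gauge f -> (forall i, f [ffun j => (i == j : nat)] <= 1) ->
  exists C : {set T}, f w = \sum_(i in C) w i
    /\ forall x : {ffun T -> nat}, \sum_(i in C) x i <= f x.
Proof.
move=> gauge_f f1; pose U i : {ffun T -> nat} := [ffun j => (i == j : nat)].
have [g [[_ homg _] gf gw addg]] :=
  gauge_support w [seq U i | i <- enum T] gauge_f.
have g0 : g 0%R = 0 by have := homg 0%R 0; rewrite mulr0n.
have {}addg i x : g (U i + x)%R = g (U i) + g x.
  by apply: addg; apply: map_f; rewrite mem_enum.
have xE (x : {ffun T -> nat}) : x = (\sum_i U i *+ x i)%R.
  apply/ffunP => j; rewrite sum_ffunE (bigD1 j) //= big1 ?addr0.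
    by rewrite ffunMnE ffunE eqxx /= natn.
  by move=> i /negPf ij; rewrite ffunMnE ffunE ij mul0rn.
have gE x : g x = \sum_i x i * g (U i).
  rewrite {1}(xE x).
  elim: (index_enum T) => [|i r IHr]; first by rewrite !big_nil.
  rewrite !big_cons -IHr; move: (\sum_(j <- r) _)%R => y.
  elim: (x i) => [|n IHn]; first by rewrite mulr0n add0r.
  by rewrite mulrS -addrA addg IHn addnA.
pose C := [set i | 0 < g (U i)].
have gC x : g x = \sum_(i in C) x i.
  rewrite gE [RHS]big_mkcond; apply: eq_bigr => i _; rewrite inE.
  have := leq_trans (gf (U i)) (f1 i).
  by case: (g (U i)) => [|[|//]]; rewrite (muln0, muln1).
by exists C; split=> [|x]; rewrite -gC ?gw.
Qed.

(** * Covering weights by faces *)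

Section CoverNumber.
Variables (T : finType) (Delta : {set {set T}}).
Implicit Types (w x y : {ffun T -> nat}) (F W C : {set T}).

Definition coverable w k : bool :=
  [exists s : k.-tuple {set T},
    all (mem Delta) s && [forall i, w i <= coverage s i]].

Lemma coverableP w k :
  reflect (exists s, [/\ size s = k, {subset s <= Delta}
                      & forall i, w i <= coverage s i])
          (coverable w k).
Proof.
apply: (iffP existsP) => [[s /andP[/allP sD /forallP ws]]|[s [sk sD ws]]].
  by exists s; rewrite size_tuple.
exists (tcast sk (in_tuple s)); rewrite !val_tcast /=.
by apply/andP; split; [apply/allP | apply/forallP].
Qed.

Hypothesis vertexD : forall i, [set i] \in Delta.

Lemma coverable_ex w : exists k, coverable w k.
Proof.
pose s := flatten [seq nseq (w i) [set i] | i <- enum T].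
exists (size s); apply/coverableP; exists s; split=> // [F|i].
  by move=> /flatten_mapP[i _ /nseqP[-> _]].
rewrite /coverage big_flatten big_map /= big_enum /= (bigD1 i) //=.
rewrite big_nseq inE eqxx.
by rewrite (leq_trans _ (leq_addr _ _)) // iter_addn_0 mul1n.
Qed.

Definition cover_number w : nat := ex_minn (coverable_ex w).

Lemma cover_number_min w k : coverable w k -> cover_number w <= k.
Proof. by rewrite /cover_number; case: ex_minnP => m _; apply. Qed.

Lemma cover_numberP w : coverable w (cover_number w).
Proof. by rewrite /cover_number; case: ex_minnP. Qed.

Lemma cover_number_subadditive x y :
  cover_number (x + y)%R <= cover_number x + cover_number y.
Proof.
have /coverableP[s [<- sD xs]] := cover_numberP x.
have /coverableP[t [<- tD yt]] := cover_numberP y.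
apply: cover_number_min; apply/coverableP; exists (s ++ t).
split=> [|F|i]; first exact: size_cat.
  by rewrite mem_cat => /orP[/sD|/tD].
by rewrite ffunE coverage_cat leq_add.
Qed.

Lemma cover_number_monotone x y : (forall i, x i <= y i) ->
  cover_number x <= cover_number y.
Proof.
move=> xy; have /coverableP[s [sk sD ys]] := cover_numberP y.
apply: cover_number_min; apply/coverableP; exists s; split=> // i.
exact: leq_trans (xy i) (ys i).
Qed.

Hypothesis downD : forall F F', F \in Delta -> F' \subset F -> F' \in Delta.

(** The faces of a cover are shrunk one after the other, each to its points whose
    weight is not yet used up. *)
Lemma exact_cover (w : T -> nat) s :
    {subset s <= Delta} -> (forall i, w i <= coverage s i) ->
  exists s', [/\ size s' = size s, {subset s' <= Delta} & coverage s' =1 w].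
Proof.
elim: s w => [|F s IHs] w sD ws.
  exists [::]; split=> // i; have := ws i.
  by rewrite coverage_nil leqn0 => /eqP->.
pose F' := F :&: [set i | 0 < w i].
have [||s' [ss' s'D ws']] := IHs (fun i => w i - (i \in F')).
- by move=> H Hs; apply: sD; rewrite inE Hs orbT.
- move=> i; have := ws i; rewrite coverage_cons !inE.
  by case: (i \in F) => /=; case: (w i) => [|n]; rewrite ?subn0 ?subn1.
exists (F' :: s'); split=> [|H|i]; first by rewrite /= ss'.
  rewrite inE => /predU1P[->|/s'D //].
  by apply: downD (subsetIl _ _); apply: sD; rewrite mem_head.
rewrite coverage_cons ws' subnKC // !inE.
by case: (i \in F) => //=; case: (w i).
Qed.

Definition nonface_rel : rel T :=
  [rel i j | (i != j) && ([set i; j] \notin Delta)].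

Lemma nonface_graph_sym : ssrbool.symmetric nonface_rel.
Proof. by move=> i j; rewrite /nonface_rel /= eq_sym setUC. Qed.

Lemma nonface_graph_irrefl : irreflexive nonface_rel.
Proof. by move=> i; rewrite /nonface_rel /= eqxx. Qed.

Definition nonface_graph : sgraph T :=
  SGraph nonface_graph_sym nonface_graph_irrefl.

Lemma nonface_graphE i j :
  edge nonface_graph i j = (i != j) && ([set i; j] \notin Delta).
Proof. by []. Qed.

Definition indicator W : {ffun T -> nat} := [ffun i => (i \in W : nat)].

Lemma sum_indicator C W : \sum_(i in C) indicator W i = #|C :&: W|.
Proof. by rewrite -sum_mem; apply: eq_bigr => i _; rewrite ffunE. Qed.

Lemma cover_number_face F : F \in Delta -> cover_number (indicator F) <= 1.
Proof.
move=> FD; apply: cover_number_min; apply/coverableP; exists [:: F]; split=> //.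
  by move=> H; rewrite inE => /eqP->.
by move=> i; rewrite coverage_cons coverage_nil addn0 ffunE.
Qed.

Hypothesis emptyD : set0 \in Delta.

(** The cover number is then a gauge, so at each weight it is the weight of a set
    [C] whose weight never exceeds it.  A face containing two points of [C] would
    have weight 2 and cover number 1, so [C] is a clique of the nonface graph. *)
Lemma perfect_of_homogeneous_cover :
    (forall w n, n * cover_number w <= cover_number (w *+ n)%R) ->
  perfect nonface_graph /\ Delta = stable_sets nonface_graph.
Proof.
move=> scaling.
have gauge_cover : gauge cover_number.
  split=> [x y|x n|x y]; first exact: cover_number_subadditive.
    apply/eqP; rewrite eqn_leq scaling andbT.
    elim: n => [|n IHn].
      rewrite mulr0n; apply: cover_number_min; apply/coverableP.
      by exists [::]; split=> // i; rewrite ffunE.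
    rewrite mulrS (leq_trans (cover_number_subadditive _ _)) //.
    by rewrite mulSn leq_add2l.
  by apply: cover_number_monotone => i; rewrite ffunE leq_addr.
have support w : exists C, [/\ clique nonface_graph C,
    cover_number w = \sum_(i in C) w i
    & forall x, \sum_(i in C) x i <= cover_number x].
  have [i|C [wC leC]] := gauge_set_support w gauge_cover.
    rewrite (leq_trans _ (cover_number_face (vertexD i))) //.
    by apply: cover_number_monotone => j; rewrite !ffunE inE eq_sym.
  exists C; split=> //; apply/cliqueP => i j iC jC nij.
  rewrite nonface_graphE nij /=.
  apply/negP => /cover_number_face; apply/negP; rewrite -ltnNge.
  apply: leq_trans (leC _); rewrite sum_indicator (setIidPr _) ?cards2 ?nij //.
  by apply/subsetP => k /set2P[]->.
have face_stable F : F \in Delta -> stable nonface_graph F.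
  move=> FD; apply/stableP => i j iF jF; rewrite nonface_graphE negb_and !negbK.
  by apply/orP; right; apply: (downD FD); apply/subsetP => k /set2P[]->.
split; last first.
  apply/setP => W; rewrite inE; apply/idP/idP => [/face_stable //|stW].
  have [C [clC WC _]] := support (indicator W).
  have := card_clique_stable clC stW; rewrite -sum_indicator -WC.
  have /coverableP[s [<- sD Ws]] := cover_numberP (indicator W).
  case: s sD Ws => [|F [|//]] sD Ws _.
    suff -> : W = set0 by [].
    apply/setP => i; rewrite inE; have := Ws i; rewrite coverage_nil ffunE.
    by case: (i \in W).
  apply: (downD (sD F (mem_head _ _))); apply/subsetP => i iW; have := Ws i.
  by rewrite coverage_cons coverage_nil ffunE iW addn0; case: (i \in F).
move=> W; apply/eqP; rewrite eqn_leq clique_number_chromatic andbT.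
have [C [/cliqueP clC WC _]] := support (indicator W).
have /coverableP[s [sk sD Ws]] := cover_numberP (indicator W).
have /leq_trans : chromatic_number (induced nonface_graph W) <= size s.
  apply: chromatic_number_induced_le => [|i iW].
    by apply/allP => F /sD/face_stable.
  by apply: leq_trans (Ws i); rewrite ffunE iW.
apply; rewrite sk WC sum_indicator.
apply: clique_number_induced_ge (subsetIr _ _).
by apply/cliqueP => i j /setIP[iC _] /setIP[jC _]; apply: clC.
Qed.

End CoverNumber.

(** * Monomial ideals *)

Section MonomialIdeals.
Variables (K : fieldType) (n : nat).
Implicit Types (S R : {mpoly K[n]} -> Prop) (M : 'X_{1..n} -> Prop).
Local Open Scope ring_scope.

Lemma ideal_generated_sum S (s : seq ({mpoly K[n]} * {mpoly K[n]})) :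
    (forall x, x \in s -> ideal_generated_by S x.2) ->
  ideal_generated_by S (\sum_(x <- s) x.1 * x.2).
Proof.
elim: s => [|x s IHs] hs; first by exists [::]; split=> //; rewrite !big_nil.
have [|t [tS ex]] := hs x; first exact: mem_head.
have [y ys|t' [t'S e]] := IHs; first by apply: hs; rewrite inE ys orbT.
exists ([seq (x.1 * y.1, y.2) | y <- t] ++ t'); split.
  move=> y; rewrite mem_cat => /orP[/mapP[z zt ->]|]; last exact: t'S.
  exact: (tS z zt).
rewrite big_cons ex e big_cat big_map mulr_sumr; congr (_ + _).
by apply: eq_bigr => y _; rewrite mulrA.
Qed.

Lemma ideal_generated_mull S p q : S q -> ideal_generated_by S (p * q).
Proof.
move=> Sq; exists [:: (p, q)]; split; last by rewrite big_seq1.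
by move=> x; rewrite inE => /eqP->.
Qed.

Lemma ideal_generated_mono S R p :
    (forall q, S q -> ideal_generated_by R q) ->
  ideal_generated_by S p -> ideal_generated_by R p.
Proof.
by move=> SR [s [sS ->]]; apply: ideal_generated_sum => x /sS; apply: SR.
Qed.

Lemma monomial_ideal_gen M m : M m ->
  ideal_generated_by (fun q => exists2 m', M m' & q = 'X_[m'])
    ('X_[m] : {mpoly K[n]}).
Proof.
by move=> Mm; rewrite -['X_[m]]mul1r; apply: ideal_generated_mull; exists m.
Qed.

(** Comparing coefficients at [m], some summand of a representation of ['X_[m]]
    contains the monomial [m]. *)
Lemma monomial_ideal_divisor M m :
    ideal_generated_by (fun q => exists2 m', M m' & q = 'X_[m'] :> {mpoly K[n]})
      'X_[m] ->
  exists2 m', M m' & (m' <= m)%MM.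
Proof.
move=> [s [sM e]].
have : m \in msupp ('X_[m] : {mpoly K[n]}) by rewrite msuppX mem_head.
rewrite e => /msupp_sum_le /flatten_mapP[x].
rewrite mem_filter /= => /sM[m' Mm' ->].
rewrite (perm_mem (msuppMX _ _)) => /mapP[m'' _ ->].
by exists m' => //; apply: lem_addr.
Qed.

Lemma mpolyX_divisor m m' : (m' <= m)%MM ->
  'X_[m] = 'X_[m - m'] * 'X_[m'] :> {mpoly K[n]}.
Proof. by move=> le; rewrite -mpolyXD submK. Qed.

End MonomialIdeals.

(** * Reverse lexicographic orders *)

Section RevLex.
Variables (n : nat) (r : rel 'I_n).
Hypothesis total_r : total_ordering r.
Implicit Types (u v t : 'X_{1..n}).

Lemma total_ordering_min (P : pred 'I_n) i : P i ->
  exists2 j, P j & forall k, P k -> r j k.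
Proof.
have [r_refl _ r_trans r_total] := total_r => Pi.
have [j Pj minj] := extremumP (fun j : 'I_n => j) r_refl r_trans r_total Pi.
by exists j.
Qed.

(** The smallest variable at which [u] and [v] differ is at most [i], and there
    [u] has the larger exponent. *)
Lemma revlex_lt_dominant u v i : mdeg u = mdeg v -> v i < u i ->
  (forall j, r j i -> v j <= u j) -> revlex_lt r u v.
Proof.
have [_ _ r_trans _] := total_r => e_uv ltvu le_vu; right; split=> //.
have nei : u i != v i by rewrite gtn_eqF.
have [j nej minj] := total_ordering_min (P := fun j => u j != v j) nei.
have rji : r j i by apply: minj.
exists j => [|k rkj nkj]; first by rewrite ltn_neqAle eq_sym nej le_vu.
apply/eqP; apply: contraT => /minj rjk.
have [_ r_anti _ _] := total_r.
by case/eqP: nkj; apply: r_anti; rewrite rkj rjk.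
Qed.

Lemma revlex_lt_irrefl u : ~ revlex_lt r u u.
Proof. by case=> [|[_ [i]]]; rewrite ltnn. Qed.

Lemma revlex_lt_trans u v t :
  revlex_lt r u v -> revlex_lt r v t -> revlex_lt r u t.
Proof.
have [r_refl r_anti r_trans r_total] := total_r.
case=> [duv|[duv [i ltvu iuv]]] [dvt|[dvt [j lttv jvt]]]; try by left; lia.
right; split; first by rewrite duv.
have [eij|nij] := eqVneq i j.
  rewrite -eij in lttv jvt; exists i => [|k ki nk]; first exact: ltn_trans ltvu.
  by rewrite iuv ?jvt.
have [rij|rji] := orP (r_total i j).
  exists i => [|k ki nk]; first by rewrite -jvt.
  have nkj : k != j.
    by apply: contraNneq nij => kj; apply/eqP/r_anti; rewrite rij -kj ki.
  by rewrite iuv // jvt // (r_trans i).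
exists j => [|k kj nk]; first by rewrite iuv // eq_sym.
have nki : k != i.
  by apply: contraNneq nij => ki; apply/eqP/r_anti; rewrite rji -ki kj.
by rewrite iuv ?jvt // (r_trans j).
Qed.

Lemma revlex_lt_add u v t :
  revlex_lt r u v -> revlex_lt r (u + t)%MM (v + t)%MM.
Proof.
rewrite /revlex_lt !mdegD ltn_add2r => -[|[-> [i lti eqi]]]; [by left|right].
split=> //; exists i => [|j rji nji]; first by rewrite !mnmDE ltn_add2r.
by rewrite !mnmDE eqi.
Qed.

(** There are finitely many monomials of a given degree, and each step down
    strictly shrinks the set of monomials below. *)
Lemma revlex_minimal (P : 'X_{1..n} -> Prop) k u :
    (forall v, P v -> mdeg v = k) -> P u ->
  exists2 v, P v & forall t, P t -> ~ revlex_lt r t v.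
Proof.
move=> degP.
pose lt t v : bool := excluded_middle_informative (revlex_lt r t v).
have ltP t v : reflect (revlex_lt r t v) (lt t v) by apply: sumboolP.
pose below v := [set t : 'X_{1..n < k.+1} | lt t v].
have [N] := ubnP #|below u|; elim: N u => // N IHN u ltN Pu.
case: (classic (exists2 t, P t & revlex_lt r t u)) => [[t Pt tu]|no].
  apply: (IHN t) => //; rewrite ltnS in ltN; apply: leq_trans ltN.
  have tk : mdeg t < k.+1 by rewrite (degP t Pt).
  apply: proper_card; apply/properP; split.
    apply/subsetP => x; rewrite !inE => /ltP xt.
    by apply/ltP; apply: revlex_lt_trans tu.
  exists (BMultinom tk); rewrite !inE; first exact/ltP.
  by apply/negP => /ltP; apply: revlex_lt_irrefl.
by exists u => // t Pt tu; apply: no; exists t.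
Qed.

End RevLex.

Lemma total_ordering_with_min n (j0 : 'I_n) :
  exists2 r : rel 'I_n, total_ordering r & forall j, r j0 j.
Proof.
pose key (j : 'I_n) : nat := if j == j0 then 0 else j.+1.
have key_inj : injective key.
  move=> i j; rewrite /key; case: eqP => [->|_]; case: eqP => [->|_] //.
  by case=> /val_inj.
exists (fun i j => key i <= key j) => [|j]; last by rewrite /key eqxx.
split=> [i|i j|j i k|i j]; first exact: leqnn.
- by rewrite -eqn_leq => /eqP/key_inj.
- exact: leq_trans.
- exact: leq_total.
Qed.

(** * Fibers of the toric map *)

Section ToricFibers.
Variables (d : nat) (Delta : {set {set 'I_d}}).
Implicit Types (m u v : 'X_{1..#|Delta|}).

Definition face_sum m (i : 'I_d) : nat := \sum_j m j * (i \in enum_val j).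

(** By [toric_exponent_eq] below, this says that the toric map sends both
    monomials to the same Laurent monomial. *)
Definition same_fiber m m' : Prop :=
  mdeg m = mdeg m' /\ face_sum m =1 face_sum m'.

Lemma same_fiber_trans m2 m1 m3 :
  same_fiber m1 m2 -> same_fiber m2 m3 -> same_fiber m1 m3.
Proof. by move=> [e1 h1] [e2 h2]; split=> [|i]; rewrite ?e1 ?h1. Qed.

Lemma face_sumD m m' i : face_sum (m + m')%MM i = face_sum m i + face_sum m' i.
Proof.
by rewrite -big_split; apply: eq_bigr => j _; rewrite mnmDE mulnDl.
Qed.

Lemma face_sumMn m N i : face_sum (m *+ N)%MM i = N * face_sum m i.
Proof.
rewrite /face_sum big_distrr; apply: eq_bigr => j _.
by rewrite mulmnE mulnAC mulnC.
Qed.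

Lemma face_sum1 j i : face_sum U_(j)%MM i = (i \in enum_val j).
Proof.
rewrite /face_sum (bigD1 j) //= mnm1E eqxx mul1n big1 ?addn0 // => k /negPf nkj.
by rewrite mnm1E eq_sym nkj.
Qed.

Lemma same_fiberD m m' t : same_fiber m m' -> same_fiber (m + t)%MM (m' + t)%MM.
Proof.
by move=> [e h]; split=> [|i]; rewrite ?mdegD ?face_sumD ?e ?h.
Qed.

Lemma sum_face_sum (C : {set 'I_d}) m :
  \sum_(i in C) face_sum m i = \sum_j m j * #|C :&: enum_val j|.
Proof.
rewrite exchange_big; apply: eq_bigr => j _.
by rewrite -big_distrr /= sum_mem.
Qed.

Lemma monomial_of_faces (s : seq {set 'I_d}) : {subset s <= Delta} ->
  exists m, mdeg m = size s /\ face_sum m =1 coverage s.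
Proof.
elim: s => [|F s IHs] sD.
  exists 0%MM; split=> [|i]; first exact: mdeg0.
  by rewrite coverage_nil /face_sum big1 // => j _; rewrite mnm0E.
have [|m [degm summ]] := IHs; first by move=> H Hs; rewrite sD // inE Hs orbT.
have FD : F \in Delta by rewrite sD ?mem_head.
exists (U_(enum_rank_in FD F) + m)%MM; split=> [|i].
  by rewrite mdegD mdeg1 degm.
by rewrite face_sumD face_sum1 enum_rankK_in // coverage_cons summ.
Qed.

Lemma faces_of_monomial m :
  exists s, [/\ size s = mdeg m, {subset s <= Delta}
             & coverage s =1 face_sum m].
Proof.
exists (flatten [seq nseq (m j) (enum_val j) | j <- enum 'I_#|Delta|]); split.
- rewrite size_flatten /shape -map_comp sumnE big_map big_enum /= mdegE.
  by apply: eq_bigr => j _; rewrite size_nseq.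
- by move=> F /flatten_mapP[j _ /nseqP[-> _]]; apply: enum_valP.
- move=> i; rewrite /coverage big_flatten big_map big_enum /=.
  by apply: eq_bigr => j _; rewrite big_nseq iter_addn_0 mulnC.
Qed.

Lemma incidence_matrixE i j :
  incidence_matrix Delta i j = ((i \in enum_val j)%:R)%R.
Proof.
rewrite mxE /rho summxE; have [ij|nij] := boolP (i \in _).
  rewrite (bigD1 i) //= mxE !eqxx big1 // => k /andP[_ /negPf nki].
  by rewrite mxE eq_sym nki.
rewrite big1 // => k kj; rewrite mxE; case: eqP => // ik.
by rewrite ik kj in nij.
Qed.

Lemma incidence_col_eq0 j :
  col j (incidence_matrix Delta) = 0%R <-> enum_val j = set0.
Proof.
split=> [col0|j0].
  apply/setP => i; have /matrixP/(_ i ord0) := col0.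
  by rewrite mxE incidence_matrixE mxE inE; case: (i \in _).
by apply/matrixP => i k; rewrite mxE incidence_matrixE j0 !mxE inE.
Qed.

Section ToricIdeal.
Variable K : fieldType.
Local Open Scope ring_scope.
Local Notation A := (incidence_matrix Delta).

Definition face_exponent (j : 'I_#|Delta|) : 'X_{1..d.+1} :=
  (\sum_(i in enum_val j) U_(widen_ord (leqnSn d) i) + U_(ord_max))%MM.

Definition toric_exponent m : 'X_{1..d.+1} :=
  (\sum_j face_exponent j *+ m j)%MM.

Lemma face_exponent_max j : face_exponent j ord_max = 1%N.
Proof.
rewrite /face_exponent mnmDE mnm1E eqxx mnm_sumE big1 // => i _.
by rewrite mnm1E -val_eqE /= ltn_eqF.
Qed.

Lemma face_exponent_vertex j i :
  face_exponent j (widen_ord (leqnSn d) i) = (i \in enum_val j).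
Proof.
rewrite /face_exponent mnmDE mnm1E -[ord_max == _]val_eqE /= gtn_eqF // addn0.
rewrite mnm_sumE; have [ij|nij] := boolP (i \in enum_val j).
  rewrite (bigD1 i) //= mnm1E eqxx big1 ?addn0 // => k /andP[_ /negPf nki].
  by rewrite mnm1E -val_eqE /= val_eqE nki.
rewrite big1 // => k kj; rewrite mnm1E -val_eqE /= val_eqE.
by case: eqP => // ki; rewrite -ki kj in nij.
Qed.

Lemma toric_exponent_eq m m' :
  toric_exponent m = toric_exponent m' <-> same_fiber m m'.
Proof.
have degE x : toric_exponent x ord_max = mdeg x.
  rewrite mnm_sumE mdegE; apply: eq_bigr => j _.
  by rewrite mulmnE face_exponent_max mul1n.
have sumE x i : toric_exponent x (widen_ord (leqnSn d) i) = face_sum x i.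
  rewrite mnm_sumE; apply: eq_bigr => j _.
  by rewrite mulmnE face_exponent_vertex mulnC.
split=> [e|[degm summ]].
  by split=> [|i]; rewrite -?degE -?sumE e.
apply/mnmP => i; have [ltid|leid] := ltnP i d.
  have -> : i = widen_ord (leqnSn d) (Ordinal ltid) by apply: val_inj.
  by rewrite !sumE.
have -> : i = ord_max by apply/val_inj/eqP; rewrite eqn_leq leid -ltnS ltn_ord.
by rewrite !degE.
Qed.

Lemma toric_monomialE j :
  toric_monomial K (col j A) = tofrac 'X_[face_exponent j].
Proof.
rewrite /toric_monomial mpolyXD rmorphM /=; congr (_ * _).
rewrite -mprodXE rmorph_prod /= [RHS]big_mkcond; apply: eq_bigr => i _.
by rewrite mxE incidence_matrixE; case: (i \in _).
Qed.

Lemma toric_homE (p : {mpoly K[#|Delta|]}) :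
  toric_hom A p = tofrac (\sum_(m <- msupp p) p@_m *: 'X_[toric_exponent m]).
Proof.
rewrite /toric_hom /mmap rmorph_sum; apply: eq_bigr => m _.
rewrite -mul_mpolyC rmorphM; congr (_ * _).
rewrite -mprodXnE rmorph_prod; apply: eq_bigr => j _.
by rewrite toric_monomialE rmorphXn.
Qed.

(** If [m] were alone in its fiber, its coefficient in [p] would be that of its
    image in the image of [p], which is 0. *)
Lemma toric_ideal_fiber (p : {mpoly K[#|Delta|]}) m :
    toric_ideal A p -> m \in msupp p ->
  exists m', [/\ m' \in msupp p, m' != m & same_fiber m' m].
Proof.
rewrite /toric_ideal toric_homE => /eqP; rewrite tofrac_eq0 => /eqP e mp.
pose twin m' := (m' != m) && (toric_exponent m' == toric_exponent m).
have [/hasP[m' m'p /andP[ne /eqP em]]|/hasPn no] := boolP (has twin (msupp p)).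
  by exists m'; split=> //; apply/toric_exponent_eq.
have := congr1 (mcoeff (toric_exponent m)) e.
rewrite mcoeff0 raddf_sum (bigD1_seq m) ?msupp_uniq //=.
rewrite mcoeffZ mcoeffX eqxx mulr1 big_seq_cond.
rewrite big1 ?addr0 => [/eqP|m' /andP[/no + nm]]; first by rewrite mcoeff_eq0 mp.
by rewrite /twin nm /= mcoeffZ mcoeffX => /negPf->; rewrite mulr0.
Qed.

Lemma toric_ideal_binomial m m' : same_fiber m m' ->
  toric_ideal A ('X_[m] - 'X_[m'] : {mpoly K[#|Delta|]}).
Proof.
move=> /toric_exponent_eq e; pose f := @toric_hom K d _ A.
have fX x : f 'X_[x] = tofrac 'X_[toric_exponent x].
  by rewrite /f toric_homE msuppX big_seq1 mcoeffX eqxx scale1r.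
have fB p q : f (p - q) = f p - f q.
  pose g : {additive K -> rat_fun K d} :=
    @tofrac {mpoly K[d.+1]} \o @mpolyC d.+1 K.
  exact: (mmapB (fun j => toric_monomial K (col j A)) g p q).
by rewrite /toric_ideal -/(f _) fB !fX e subrr.
Qed.

End ToricIdeal.

End ToricFibers.

(** * The initial ideal *)

Section InitialIdeal.
Variables (K : fieldType) (d : nat) (Delta : {set {set 'I_d}}).
Variable r : rel 'I_#|Delta|.
Hypothesis total_r : total_ordering r.
Implicit Types (m u v t : 'X_{1..#|Delta|}).
Local Notation in_I :=
  (initial_ideal (revlex_lt r) (@toric_ideal K d _ (incidence_matrix Delta))).

(** The monomials of the initial ideal; the standard ones are the least elements
    of their fibers. *)
Definition nonstandard m : Prop :=
  exists2 m', revlex_lt r m' m & same_fiber m' m.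

Lemma nonstandard_dvd m m' : (m' <= m)%MM -> nonstandard m' -> nonstandard m.
Proof.
move=> le [t lt_t fib]; rewrite -(submK le) addmC; move: (m - m')%MM => c.
by exists (t + c)%MM; [apply: revlex_lt_add|apply: same_fiberD].
Qed.

Lemma initial_toric_ideal p :
  in_I p <->
  ideal_generated_by (fun q => exists2 m, nonstandard m & q = 'X_[m]) p.
Proof.
split; apply: ideal_generated_mono => q.
  move=> [f [m [fI [mf lt_m] ->]]]; apply: monomial_ideal_gen.
  have [m' [m'f ne fib]] := toric_ideal_fiber fI mf.
  by exists m' => //; apply: lt_m.
move=> [m [m' lt fib] ->]; rewrite -['X_[m]]mul1r.
have ne : m' != m.
  by apply: contraPneq lt => ->; apply: revlex_lt_irrefl.
apply: ideal_generated_mull; exists ('X_[m] - 'X_[m'])%R, m; split=> //.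
  apply: toric_ideal_binomial; case: fib => e h.
  by split=> [|i]; rewrite ?e ?h.
split.
  by rewrite mcoeff_msupp mcoeffB !mcoeffX eqxx (negPf ne) subr0 oner_eq0.
move=> m1 /msuppB_le; rewrite mem_cat !msuppX !inE.
by case/orP=> /eqP-> // /eqP.
Qed.

Definition squarefree_part m : 'X_{1..#|Delta|} :=
  [multinom (0 < m i : nat) | i < #|Delta|].

Lemma squarefree_of_nonstandard :
    (forall m, nonstandard m -> nonstandard (squarefree_part m)) ->
  squarefree_ideal in_I.
Proof.
move=> sqf; exists (fun m => squarefree_monomial m /\ nonstandard m).
split=> [m []//|p].
split=> [/initial_toric_ideal|sf]; last first.
  apply/initial_toric_ideal; apply: ideal_generated_mono sf => q [m [_ nm] ->].
  exact: monomial_ideal_gen.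
apply: ideal_generated_mono => q [m nm ->].
have le : (squarefree_part m <= m)%MM.
  by apply/mnm_lepP => i; rewrite mnmE; case: (m i).
rewrite (mpolyX_divisor K le); apply: ideal_generated_mull.
exists (squarefree_part m) => //; split; last exact: sqf.
by move=> i; rewrite mnmE; case: (m i).
Qed.

(** A squarefree divisor of a power of [m] divides [m]. *)
Lemma squarefree_nonstandard_root m N :
  squarefree_ideal in_I -> nonstandard (m *+ N)%MM -> nonstandard m.
Proof.
move=> [S [sfS SE]] nm.
have /SE/monomial_ideal_divisor[s Ss les] : in_I 'X_[m *+ N].
  by apply/initial_toric_ideal/monomial_ideal_gen.
have /initial_toric_ideal/monomial_ideal_divisor[t nt le_ts] : in_I 'X_[s].
  by apply/SE/monomial_ideal_gen.
apply: nonstandard_dvd nt; apply: lepm_trans le_ts _.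
apply/mnm_lepP => i; have /mnm_lepP/(_ i) := les; rewrite mulmnE.
by have := sfS s Ss i; case: (s i) => [|[|//]] // _; case: (m i).
Qed.

Lemma fiber_standard u : exists2 v, same_fiber v u & ~ nonstandard v.
Proof.
have [||v vu minv] :=
  revlex_minimal total_r (P := fun v => same_fiber v u) (k := mdeg u) (u := u).
- by move=> v [].
- by split.
exists v => // -[t lt_t tv]; apply: (minv t) => //.
exact: same_fiber_trans vu.
Qed.

(** Write [m = u c] and [m' = v c], where [m'] is a smaller monomial in the fiber
    of [m] and [c] is their common factor, and let [i] be the smallest variable
    at which they differ.  The squarefree part [u0] of [u] divides that of [m].
    The weight of [u0] minus the face [i] satisfies the clique bounds of
    [perfect_decomposition], and the resulting decomposition into faces, together
    with [i], is a monomial below [u0] in its fiber. *)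
Lemma nonstandard_squarefree_part (G : sgraph 'I_d) m :
    perfect G -> Delta = stable_sets G -> nonstandard m ->
  nonstandard (squarefree_part m).
Proof.
move=> perfG DG [m' [lt|[degm [i ltmi eqm]]] [degm' summ]].
  by rewrite degm' ltnn in lt.
have DE (F : {set 'I_d}) : (F \in Delta) = stable G F by rewrite DG inE.
have faceG (j : 'I_#|Delta|) : stable G (enum_val j : {set 'I_d}).
  by rewrite -DE; apply: enum_valP.
pose u := (m - m')%MM; pose v := (m' - m)%MM; pose c := (m - u)%MM.
have uE : m = (u + c)%MM by apply/mnmP => j; rewrite !mnmE; lia.
have vE : m' = (v + c)%MM by apply/mnmP => j; rewrite !mnmE; lia.
have {}degm : mdeg u = mdeg v.
  by apply/(@addIn (mdeg c)); rewrite -!mdegD -uE -vE.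
have {}summ a : face_sum u a = face_sum v a.
  by apply/(@addIn (face_sum c a)); rewrite -!face_sumD -uE -vE.
have vi : 0 < v i by rewrite mnmE subn_gt0.
pose u0 := squarefree_part u; pose Fi := enum_val i : {set 'I_d}.
have u0E j : u0 j = (0 < u j) by rewrite mnmE.
have u0i : u0 i = 0 by rewrite u0E mnmE; lia.
have le_u0 : (u0 <= squarefree_part m)%MM.
  by apply/mnm_lepP => j; rewrite u0E !mnmE; lia.
apply: nonstandard_dvd le_u0 _.
(* Each point of [Fi] is covered by [v], hence by [u], hence by [u0]. *)
have Fi_u0 a : (a \in Fi) <= face_sum u0 a.
  have [aF|//] := boolP (a \in Fi).
  have : 0 < face_sum u a.
    by rewrite summ /face_sum (bigD1 i) //= aF muln1 (leq_trans vi) ?leq_addr.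
  rewrite !lt0n !sum_nat_eq0 !negb_forall => /existsP[j]; rewrite implyTb => uj.
  apply/existsP; exists j; rewrite implyTb u0E.
  by move: uj; rewrite !muln_eq0; case: (u j).
have wC C : clique G C ->
    \sum_(a in C) (face_sum u0 a - (a \in Fi)) <= (mdeg u0).-1.
  move=> clC.
  have card1 (j : 'I_#|Delta|) : #|C :&: enum_val j| <= 1.
    exact: card_clique_stable clC (faceG j).
  have e : \sum_(a in C) (face_sum u0 a - (a \in Fi)) + #|C :&: Fi|
      = \sum_j u0 j * #|C :&: enum_val j|.
    rewrite -sum_face_sum -sum_mem -big_split /=; apply: eq_bigr => a _.
    exact: subnK.
  have le_deg : \sum_j u0 j * #|C :&: enum_val j| <= mdeg u0.
    rewrite mdegE; apply: leq_sum => j _.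
    by rewrite -[leqRHS]muln1 leq_mul2l card1 orbT.
  have [CF|] := posnP #|C :&: Fi|; last by move: e le_deg; lia.
  (* If every face of [u] met [C], then [u], and with it [v], would have weight
     [mdeg u = mdeg v] on [C], although the face [i] of [v] misses [C]. *)
  have [j /andP[uj Cj]] : exists j, (0 < u j) && (#|C :&: enum_val j| == 0).
    apply/existsP; apply: contraT => /existsPn no.
    have : \sum_j u j * #|C :&: enum_val j| = mdeg u.
      rewrite mdegE; apply: eq_bigr => j _; have := no j; have := card1 j.
      by case: (u j) => // n; case: #|_| => [|[|]] //; rewrite muln1.
    rewrite -sum_face_sum (eq_bigr _ (fun a _ => summ a)) sum_face_sum.
    rewrite degm mdegE (bigD1 i) //= [X in _ = X](bigD1 i) //= CF muln0 add0n.
    have : \sum_(j | j != i) v j * #|C :&: enum_val j| <= \sum_(j | j != i) v j.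
      by apply: leq_sum => j _; rewrite -[leqRHS]muln1 leq_mul2l card1 orbT.
    move=> /[swap] ->; rewrite leqNgt -{1}[X in X < _]add0n.
    by rewrite ltn_add2r vi.
  move: e; rewrite CF addn0 => ->.
  rewrite mdegE (bigD1 j) //= (eqP Cj) muln0 add0n.
  rewrite [X in _ <= X.-1](bigD1 j) //= u0E uj /=.
  by apply: leq_sum => k _; rewrite -[leqRHS]muln1 leq_mul2l card1 orbT.
have [s [size_s st sw]] := perfect_decomposition perfG wC.
have [|t [degt sumt]] := @monomial_of_faces d Delta s.
  by move=> F /(allP st); rewrite DE.
have deg_u0 : 0 < mdeg u0.
  have : 0 < mdeg u.
    by rewrite degm mdegE (bigD1 i) //= (leq_trans vi) ?leq_addr.
  rewrite !mdegE !lt0n !sum_nat_eq0 !negb_forall => /existsP[j].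
  rewrite implyTb => uj.
  by apply/existsP; exists j; rewrite implyTb u0E; move: uj; case: (u j).
have deg_v0 : mdeg (U_(i) + t)%MM = mdeg u0.
  by rewrite mdegD mdeg1 degt size_s add1n prednK.
exists (U_(i) + t)%MM.
  apply: (revlex_lt_dominant total_r (i := i)) => //.
    by rewrite u0i mnmDE mnm1E eqxx.
  move=> j rji; have [->|nji] := eqVneq j i; first by rewrite u0i.
  by rewrite u0E mnmE eqm // subnn.
split=> // a; rewrite face_sumD face_sum1 sumt sw subnKC //.
Qed.

Section ScalingCovers.
Hypothesis vertexD : forall i, [set i] \in Delta.
Hypothesis downD : forall F F' : {set 'I_d},
  F \in Delta -> F' \subset F -> F' \in Delta.
Variable j0 : 'I_#|Delta|.
Hypothesis empty_j0 : enum_val j0 = set0.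
Local Notation f := (cover_number vertexD).

Lemma cover_number_monomial (w : {ffun 'I_d -> nat}) :
  exists m, mdeg m = f w /\ face_sum m =1 w.
Proof.
have /coverableP[s [size_s sD ws]] := cover_numberP vertexD w.
have [s' [size_s' s'D s'w]] := exact_cover downD sD ws.
have [m [degm summ]] := monomial_of_faces s'D.
by exists m; split=> [|i]; rewrite ?degm ?size_s' ?summ.
Qed.

(** Let [v] be the least monomial in a fiber of degree [f w] over [w].  It does
    not involve the empty face, since that face could be dropped.  A cover of
    [N w] by fewer than [N (f w)] faces, completed by copies of the empty face,
    lies in the fiber of the power [v ^ N] and below it, as [j0] is the smallest
    variable. *)
Lemma cover_number_scaling (w : {ffun 'I_d -> nat}) N :
    (forall j, r j0 j) -> squarefree_ideal in_I ->
  N * f w <= f (w *+ N)%R.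
Proof.
move=> min_j0 sf; rewrite leqNgt; apply/negP => lt_f.
have [m [degm summ]] := cover_number_monomial w.
have [v [degv sumv] std_v] := fiber_standard m.
have {}sumv : face_sum v =1 w by move=> i; rewrite sumv summ.
have {}degv : mdeg v = f w by rewrite degv.
have v0 : v j0 = 0.
  apply/eqP; apply: contraT; rewrite -lep1mP => le1.
  have [s [size_s sD sv]] := faces_of_monomial (v - U_(j0))%MM.
  have : f w <= (f w).-1; last by move: lt_f; case: (f w); lia.
  apply: cover_number_min; apply/coverableP; exists s; split=> //.
    by rewrite size_s -degv -[in RHS](submK le1) mdegD mdeg1 addn1.
  move=> i; rewrite sv -sumv -{1}(submK le1) face_sumD face_sum1.
  by rewrite empty_j0 inE addn0.
apply: std_v; apply: (squarefree_nonstandard_root (N := N) sf).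
have [t [degt sumt]] := cover_number_monomial (w *+ N)%R.
pose c := (N * f w - f (w *+ N)%R)%N.
have deg_eq : mdeg (t + U_(j0) *+ c)%MM = mdeg (v *+ N)%MM.
  rewrite mdegD !mdegMn mdeg1 mul1n degt degv /c mulnC.
  by rewrite subnKC // ltnW // mulnC.
exists (t + U_(j0) *+ c)%MM.
  apply: (revlex_lt_dominant total_r (i := j0)) => // [|j rj].
    by rewrite mnmDE !mulmnE v0 mnm1E eqxx mul1n /c; lia.
  have [_ anti_r _ _] := total_r.
  have -> : j = j0 by apply: anti_r; rewrite rj min_j0.
  by rewrite mulmnE v0.
split=> // i; rewrite face_sumD !face_sumMn face_sum1 empty_j0 inE muln0 addn0.
rewrite sumt sumv ffunMnE.
by elim: N {lt_f t degt sumt c deg_eq} => // N IHN; rewrite mulrS IHN mulSn.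
Qed.

End ScalingCovers.

End InitialIdeal.

(** * Compressed incidence matrices and perfect graphs *)

Theorem theorem2p6 (K : fieldType) (d : nat) (Delta : {set {set 'I_d}})
    (hDelta : simplicial_complex Delta) :
  let A := incidence_matrix Delta in
  let P1 := exists G : sgraph 'I_d, perfect G /\ Delta = stable_sets G in
  let P2 := compressed K A in
  let P3 :=
    exists r : rel 'I_#|Delta|,
      [/\ total_ordering r,
          exists j0 : 'I_#|Delta|, col j0 A = 0%R /\ forall j, r j0 j
        & squarefree_ideal (initial_ideal (revlex_lt r) (@toric_ideal K d _ A))]
  in
  (P1 <-> P2) /\ (P2 <-> P3).
Proof.
move=> A P1 P2 P3.
have [emptyD vertexD downD] := hDelta.
have P12 : P1 -> P2.
  move=> [G [perfG DG]] r total_r; apply: squarefree_of_nonstandard => m.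
  exact: nonstandard_squarefree_part perfG DG.
have P23 : P2 -> P3.
  move=> compr; have [r total_r min_r] :=
    total_ordering_with_min (enum_rank_in emptyD set0).
  exists r; split=> //; last exact: compr.
  exists (enum_rank_in emptyD set0); split=> //.
  by apply/incidence_col_eq0; rewrite enum_rankK_in.
have P31 : P3 -> P1.
  move=> [r [total_r [j0 [/incidence_col_eq0 empty_j0 min_j0]] sf]].
  exists (nonface_graph Delta).
  apply: (perfect_of_homogeneous_cover (vertexD := vertexD)) => // w N.
  exact: (cover_number_scaling total_r vertexD downD empty_j0 w N min_j0 sf).
by split; split=> // h; [apply/P31/P23|apply/P12/P31].
Qed.
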